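(* Let $k\ge 1$, $n\ge 1$, $m=kn+1$, and let $D\in\mathcal D_{m,n}$. Let $\overline D=\Phi^{-1}(D)$, let $r_1<r_2<\dots<r_{m+n}$ be the ranks of the vertices of $\overline D$ other than its final vertex $(m,n)$, and form the word $\mathrm{EN}(D)=x_1x_2\cdots x_{m+n}$ in the letters $N,E$ by letting $x_i=N$ if the step of $\overline D$ that ends at the vertex of rank $r_i$ is a North step and $x_i=E$ if it is an East step (the vertex of rank $0$ being regarded as the endpoint $(m,n)$ of the last step). Let $b_1<\dots<b_n$ be the entries of the bottom row (row $k+1$) of the tableau $T(D)$. Then $x_i=N$ if and only if $i\in\{b_1+1,\dots,b_n+1\}$; all other $m$ letters are $E$.
   Context: Let $m,n$ be coprime positive integers. $\mathcal D_{m,n}$ is the set of lattice paths from $(0,0)$ to $(m,n)$ with unit North steps $(0,1)$ and East steps $(1,0)$ staying weakly above the segment from $(0,0)$ to $(m,n)$. The rank of a lattice point $(x,y)$ is $ym-xn$ (a North step adds $m$, an East step subtracts $n$); the $m+n$ vertices of a path other than its endpoint have distinct nonnegative ranks, and the endpoint has rank $0$. The step word $\mathrm{SW}(P)$ of a path $P$ is the word of length $m+n$ whose $i$-th letter is $S$ if the $i$-th step is North and $W$ if it is East. The sweep map $\Phi:\mathcal D_{m,n}\to\mathcal D_{m,n}$ sends $P$ to the path whose $i$-th step is North iff the step of $P$ with the $i$-th smallest starting-vertex rank is North; $\Phi$ is a bijection of $\mathcal D_{m,n}$ when $m=kn+1$. Filling algorithm (for $m=kn+1$): given $D\in\mathcal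 D_{m,n}$, $T(D)$ is the array with $k+1$ rows and $n$ columns built by reading the first $m+n-1$ letters of $\mathrm{SW}(D)$: place $1$ at the top of column $1$; for $i=2,\dots,m+n-1$, if the $i$-th letter is $S$ place $i$ at the top of the leftmost empty column, and if it is $W$ place $i$ immediately below the smallest active entry, where an entry is active if it is currently the lowest entry of its column and is not in row $k+1$. The result is a standard Young tableau of rectangular shape with entries $1,\dots,(k+1)n$. *)

(* Defs.v *)
From HB Require Import structures.
From mathcomp Require Import all_boot all_order all_algebra.
Set Implicit Arguments.
Unset Strict Implicit.
Unset Printing Implicit Defensive.

Inductive step := North | East.

Definition step_eqb (s t : step) : bool :=
  match s, t with North, North | East, East => true | _, _ => false end.

Lemma step_eqP : Equality.axiom step_eqb.
Proof. by case; case; constructor. Qed.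

HB.instance Definition _ := hasDecEq.Build step step_eqP.

Inductive letter := LetterS | LetterW.

(* A lattice path starting at (0, 0) is the sequence of its steps; its vertices
   are numbered 0, ..., size P, so that step number i (from 0) goes from
   vertex i to vertex i + 1. *)
Definition vertex (P : seq step) (i : nat) : nat * nat :=
  (count_mem East (take i P), count_mem North (take i P)).

Definition rank (m n : nat) (v : nat * nat) : int :=
  ((v.2 * m)%:Z - (v.1 * n)%:Z)%R.

(* A lattice path stays weakly above the segment from (0, 0) to (m, n) as soon
   as its vertices do; (x, y) is weakly above it when x n <= y m. *)
Definition dyck (m n : nat) (P : seq step) : bool :=
  (vertex P (size P) == (m, n)) &&
  all (fun i => (vertex P i).1 * n <= (vertex P i).2 * m) (iota 0 (size P).+1).

(* The indices of the vertices other than the last one, listed by increasing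
   rank. *)
Definition rank_order (m n : nat) (P : seq step) : seq nat :=
  sort (fun i j => (rank m n (vertex P i) <= rank m n (vertex P j))%R)
    (iota 0 (size P)).

Definition sweep (m n : nat) (P : seq step) : seq step :=
  [seq nth East P i | i <- rank_order m n P].

(* The step ending at vertex i; vertex 0 is identified with the endpoint. *)
Definition step_into (P : seq step) (i : nat) : step :=
  if i is j.+1 then nth East P j else last East P.

(* EN(D) for D = sweep P. *)
Definition EN (m n : nat) (P : seq step) : seq step :=
  [seq step_into P i | i <- rank_order m n P].

Definition SW (P : seq step) : seq letter :=
  [seq if s is North then LetterS else LetterW | s <- P].

(* Arrays are sequences of columns, each column being the sequence of its
   entries from top to bottom. *)
Definition array := seq (seq nat).

Definition has_active (k : nat) (c : seq nat) : bool := 0 < size c < k.+1.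

Definition active_entries (k : nat) (T : array) : seq nat :=
  [seq last 0 c | c <- T & has_active k c].

Definition smallest_active (k : nat) (T : array) : nat :=
  head 0 (sort leq (active_entries k T)).

(* Entries are pairwise distinct, so a W letter extends only one column. On the
   words of the paths in [dyck], an S letter always finds an empty column. *)
Definition place (k : nat) (T : array) (l : letter) (i : nat) : array :=
  match l with
  | LetterS => set_nth [::] T (index [::] T) [:: i]
  | LetterW =>
      [seq if has_active k c && (last 0 c == smallest_active k T)
           then rcons c i else c | c <- T]
  end.

(* [index_iota 2 (m + n)] is 2, ..., m + n - 1; letters are numbered from 1. *)
Definition tableau (k n : nat) (D : seq step) : array :=
  let m := k * n + 1 in
  foldl (fun T i => place k T (nth LetterW (SW D) i.-1) i)
    ([:: 1] :: nseq n.-1 [::]) (index_iota 2 (m + n)).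

Definition bottom_row (k : nat) (T : array) : seq nat :=
  pmap (fun c => onth c k) T.

(* Main.v *)
Require Import Defs.
From mathcomp Require Import all_boot all_order all_algebra.
From mathcomp Require Import zify.
Set Implicit Arguments.
Unset Strict Implicit.
Unset Printing Implicit Defensive.

(** Let S be the set of ranks at which the North steps of the preimage path start.
    Ranks are congruent to m times the height modulo n, so that S has one element
    in each residue class modulo n.  Let R be the grid of the numbers e + t n with
    e in S and 0 <= t <= k.

    Adding n is an increasing bijection from the non-bottom to the non-top
    elements of R, which is the first-in first-out rule of the filling algorithm.
    So the tableau is the standardization of R, as soon as each e in S has the
    same position in R as among the ranks of the path.

    A sum along the cyclic path shows that the numbers of ranks <= z and of
    elements <= z of R differ by the number of e in S such that e = z modulo n and
    e + (k + 1) n <= z.  This vanishes at z = e + t n for e in S and t <= k.  The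
    case t = 0 is the requirement above.  The case t = k says that the bottom entry
    of the column of e is the number of ranks below e + k n + 1 = e + m, the rank
    at which the North step starting at e ends. *)

Lemma head_sort_leq (s : seq nat) (x : nat) :
  x \in s -> {in s, forall y, x <= y} -> head 0 (sort leq s) = x.
Proof.
move=> xs min_x; have: sorted leq (sort leq s) by apply/sort_sorted/leq_total.
have := mem_sort leq s; case: (sort leq s) => [/(_ x)|y t mem_yt /= pt].
  by rewrite xs in_nil.
apply/eqP; rewrite eqn_leq min_x -?mem_yt ?mem_head // andbT.
move: xs; rewrite -mem_yt inE => /orP[/eqP -> //|xt].
by have /allP/(_ _ xt) := order_path_min leq_trans pt.
Qed.

Lemma filter_leqS (s : seq nat) (i : nat) : sorted ltn s ->
  [seq x <- s | x <= i.+1] =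
  if i.+1 \in s then rcons [seq x <- s | x <= i] i.+1 else [seq x <- s | x <= i].
Proof.
elim: s => // x s IH /=; rewrite (path_sortedE ltn_trans) => /andP[/allP lt_x /IH {}IH].
rewrite inE IH; case: eqVneq => [eqx|neqx] /=; last first.
  have -> : (x <= i.+1) = (x <= i) by lia.
  by case: ifP => _; case: ifP.
rewrite -eqx in lt_x *; have /negbTE -> : i.+1 \notin s.
  by apply/negP => /lt_x /=; rewrite ltnn.
have -> : [seq y <- s | y <= i] = [::]; last by rewrite leqnn ltnn.
by apply/eqP; rewrite -[_ == _]negbK -has_filter; apply/hasPn => y /lt_x /=; lia.
Qed.

Lemma mkseq_comp_nth (T1 T2 : Type) (x0 : T1) (f : T1 -> T2) (s : seq T1) :
  mkseq (f \o nth x0 s) (size s) = map f s.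
Proof. by rewrite -[in RHS](mkseq_nth x0 s) -map_comp. Qed.

Lemma eqn_mod_mul2r (m n a b : nat) :
  coprime m n -> (a * m == b * m %[mod n]) = (a == b %[mod n]).
Proof.
move=> co_mn; wlog leba : a b / b <= a => [wlog_leba|].
  case: (leqP b a) => [|/ltnW] /wlog_leba // eq_ba.
  by rewrite eq_sym eq_ba eq_sym.
by rewrite !eqn_mod_dvd ?leq_mul2r ?leba ?orbT // -mulnBl Gauss_dvdl // coprime_sym.
Qed.

(* For z in s and s without duplicates, the position of z, counted from 1, in the
   increasing enumeration of s. *)
Definition count_leq (s : seq nat) (z : nat) : nat := count (leq^~ z) s.

Lemma perm_count_leq (s1 s2 : seq nat) :
  perm_eq s1 s2 -> count_leq s1 =1 count_leq s2.
Proof. by move=> /permP eqs z; apply: eqs. Qed.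

Lemma leq_count_leq (s : seq nat) (z z' : nat) : z \in s ->
  (count_leq s z <= count_leq s z') = (z <= z').
Proof.
have sub y y' : y <= y' -> subpred (leq^~ y) (leq^~ y').
  by move=> leyy' x /leq_trans; apply.
move=> zs; case: (leqP z z') => [lezz'|ltz'z]; first exact/sub_count/sub.
apply/negbTE; rewrite -ltnNge; case/splitPr: zs => s1 s2.
rewrite /count_leq !count_cat /= leqnn (leqNgt z z') ltz'z /= add1n addnS ltnS.
by apply: leq_add; apply/sub_count/sub/ltnW.
Qed.

Lemma count_leq_inj (s : seq nat) : {in s &, injective (count_leq s)}.
Proof.
move=> z z' zs z's eqzz'; apply/eqP.
by rewrite eqn_leq -(leq_count_leq z' zs) -(leq_count_leq z z's) eqzz' leqnn.
Qed.

Lemma count_leq_gt0 (s : seq nat) (z : nat) : z \in s -> 0 < count_leq s z.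
Proof. by move=> zs; rewrite -has_count; apply/hasP; exists z => /=. Qed.

Lemma count_leq_nth_sort (s : seq nat) (i : nat) : uniq s -> i < size s ->
  count_leq s (nth 0 (sort leq s) i) = i.+1.
Proof.
move=> us lti; rewrite -(perm_count_leq (permEl (perm_sort leq s))).
apply: (@Order.POrderTheory.count_le_nth _ nat); last by rewrite size_sort.
exact: etrans (Order.TotalTheory.sort_lt_sorted _) us.
Qed.

Lemma count_leq_surj (s : seq nat) (i : nat) : uniq s -> 0 < i <= size s ->
  exists2 z, z \in s & count_leq s z = i.
Proof.
case: i => // i us /= lti; exists (nth 0 (sort leq s) i).
  by rewrite -(mem_sort leq) mem_nth // size_sort.
exact: count_leq_nth_sort.
Qed.

Lemma count_leqS (s : seq nat) (z : nat) : uniq s -> z.+1 \in s ->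
  count_leq s z.+1 = (count_leq s z).+1.
Proof.
move=> us zs; have <- : count_mem z.+1 s + count_leq s z = (count_leq s z).+1.
  by rewrite count_uniq_mem // zs.
rewrite /count_leq -count_predUI.
rewrite [X in _ + X](eq_count (a2 := pred0)) ?count_pred0 ?addn0 => [|x /=].
  by apply: eq_count => x /=; rewrite leq_eqVlt ltnS.
by case: eqVneq => // ->; rewrite ltnn.
Qed.

Definition extend_column (T : array) (j i : nat) : array :=
  set_nth [::] T j (rcons (nth [::] T j) i).

Lemma size_extend_column (T : array) (j i : nat) :
  j < size T -> size (extend_column T j i) = size T.
Proof. by move=> ltj; rewrite size_set_nth; apply/maxn_idPr. Qed.

Lemma nth_extend_column (T : array) (j i j' : nat) :
  nth [::] (extend_column T j i) j' =
  if j' == j then rcons (nth [::] T j) i else nth [::] T j'.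
Proof. exact: nth_set_nth. Qed.

Lemma place_LetterS (k i j : nat) (T : array) :
  j < size T -> nth [::] T j = [::] -> (forall j', j' < j -> nth [::] T j' != [::]) ->
  place k T LetterS i = extend_column T j i.
Proof.
move=> ltj Tj0 first_j; rewrite /place /extend_column Tj0; congr (set_nth _ _ _ _).
apply/eqP; rewrite eqn_leq -{1}Tj0 index_nth // leqNgt; apply/negP => /first_j.
by rewrite nth_index ?eqxx // -Tj0 mem_nth.
Qed.

Lemma place_LetterW (k i j : nat) (T : array) (c := nth [::] T) :
  j < size T -> has_active k (c j) ->
  (forall j', j' < size T -> j' != j -> has_active k (c j') -> last 0 (c j) < last 0 (c j')) ->
  place k T LetterW i = extend_column T j i.
Proof.
move=> ltj active_j min_j.
have smallest_j : smallest_active k T = last 0 (c j).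
  apply: head_sort_leq => [|x /mapP[d]].
    by apply: map_f; rewrite mem_filter active_j mem_nth.
  rewrite mem_filter => /andP[active_d /(nthP [::])[j' ltj' eqd]] ->.
  case: (eqVneq j' j) => [eqj|nej]; first by rewrite -eqd eqj.
  by rewrite -eqd; apply/ltnW/min_j; rewrite /c ?eqd.
apply: (@eq_from_nth _ [::]) => [|j']; first by rewrite size_extend_column // size_map.
rewrite size_map => ltj'; rewrite (nth_map [::]) // nth_extend_column smallest_j.
case: (eqVneq j' j) => [->|nej]; first by rewrite active_j eqxx.
case: ifP => // /andP[/(min_j _ ltj' nej)].
by rewrite ltn_neqAle eq_sym => /andP[/negbTE ->].
Qed.

Lemma nth_SW (D : seq step) (i : nat) :
  nth LetterW (SW D) i = if nth East D i is North then LetterS else LetterW.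
Proof.
case: (ltnP i (size D)) => [lti|lei]; first exact: nth_map.
by rewrite !nth_default ?size_map.
Qed.

Lemma tableau_foldl (k n : nat) (D : seq step) : 0 < n -> nth East D 0 = North ->
  tableau k n D =
  foldl (fun T i => place k T (nth LetterW (SW D) i.-1) i) (nseq n [::]) (iota 1 (k.+1 * n)).
Proof.
move=> n_gt0 D0; rewrite /tableau.
have -> : index_iota 2 (k * n + 1 + n) = iota 2 (k.+1 * n).-1.
  by rewrite /index_iota; congr iota; lia.
have /prednK <- : 0 < k.+1 * n by rewrite muln_gt0.
by rewrite /= nth_SW D0; case: n n_gt0.
Qed.

Lemma bottom_row_mkseq (k n : nat) (entry : nat -> nat -> nat) :
  bottom_row k (mkseq (fun j => mkseq (entry^~ j) k.+1) n) = mkseq (entry k) n.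
Proof.
set column := fun j => mkseq (entry^~ j) k.+1.
have onth_column j : onth (column j) k = Some (entry k j).
  by rewrite onthE (nth_map 0) ?size_mkseq // nth_mkseq.
rewrite /bottom_row /mkseq; clearbody column.
by elim: (iota 0 n) => //= j js ->; rewrite onth_column.
Qed.

Section FirstInFirstOut.

(* [key t j] labels the cell in row t and column j, both counted from 0. *)
Variables (k n : nat) (key : nat -> nat -> nat).

Hypothesis key_inj : forall t j t' j', t <= k -> j < n -> t' <= k -> j' < n ->
  key t j = key t' j' -> t = t' /\ j = j'.
Hypothesis ltn_key_top : forall j j', j < j' -> j' < n -> key 0 j < key 0 j'.
Hypothesis ltn_keyS : forall t j, t < k -> j < n -> key t j < key t.+1 j.
Hypothesis leq_key_above : forall t j t' j', t < k -> j < n -> t' < k -> j' < n ->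
  key t.+1 j <= key t'.+1 j' -> key t j <= key t' j'.

Definition keys : seq nat := [seq key t j | j <- iota 0 n, t <- iota 0 k.+1].
Definition entry (t j : nat) : nat := count_leq keys (key t j).
Definition column (j : nat) : seq nat := mkseq (entry^~ j) k.+1.
Definition column_upto (i j : nat) : seq nat := [seq x <- column j | x <= i].
Definition array_upto (i : nat) : array := mkseq (column_upto i) n.

Lemma mem_keys (t j : nat) : t <= k -> j < n -> key t j \in keys.
Proof.
by move=> let_k ltj; apply: (allpairs_f (fun j t => key t j)); rewrite mem_iota.
Qed.

Lemma keysP (z : nat) :
  reflect (exists t j, [/\ t <= k, j < n & z = key t j]) (z \in keys).
Proof.
apply: (iffP allpairsP) => [[[j t] []] | [t [j [let_k ltj ->]]]].
  by rewrite !mem_iota => ltj let_k ->; exists t, j.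
by exists (j, t); rewrite !mem_iota.
Qed.

Lemma keys_uniq : uniq keys.
Proof.
apply: allpairs_uniq; rewrite ?iota_uniq //.
move=> _ _ /allpairsP[[j t] [jn tk ->]] /allpairsP[[j' t'] [j'n t'k ->]].
rewrite !mem_iota in jn tk j'n t'k.
by case/(key_inj tk jn t'k j'n) => -> ->.
Qed.

Lemma size_keys : size keys = k.+1 * n.
Proof. by rewrite size_allpairs !size_iota mulnC. Qed.

Lemma leq_entry (t j t' j' : nat) : t <= k -> j < n ->
  (entry t j <= entry t' j') = (key t j <= key t' j').
Proof. by move=> let_k ltj; apply/leq_count_leq/mem_keys. Qed.

Lemma ltn_entryS (t j : nat) : t < k -> j < n -> entry t j < entry t.+1 j.
Proof. by move=> ltt ltj; rewrite ltnNge leq_entry // -ltnNge ltn_keyS. Qed.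

Lemma entry_inj (t j t' j' : nat) : t <= k -> j < n -> t' <= k -> j' < n ->
  entry t j = entry t' j' -> t = t' /\ j = j'.
Proof.
move=> let_k ltj let'k ltj' /count_leq_inj eq_key.
by apply: key_inj => //; apply: eq_key; apply: mem_keys.
Qed.

Lemma entry_gt0 (t j : nat) : t <= k -> j < n -> 0 < entry t j.
Proof. by move=> let_k ltj; apply/count_leq_gt0/mem_keys. Qed.

Lemma entry_surj (i : nat) : 0 < i <= k.+1 * n ->
  exists t j, [/\ t <= k, j < n & entry t j = i].
Proof.
rewrite -size_keys => /(count_leq_surj keys_uniq)[_ /keysP[t [j [let_k ltj ->]]] <-].
by exists t, j.
Qed.

Lemma nth_column (t j : nat) : t <= k -> nth 0 (column j) t = entry t j.
Proof. by move=> let_k; rewrite nth_mkseq. Qed.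

Lemma column_sorted (j : nat) : j < n -> sorted ltn (column j).
Proof.
move=> ltj; apply/(sortedP 0) => t; rewrite size_mkseq ltnS => ltt.
by rewrite !nth_column ?(ltnW ltt) //; apply: ltn_entryS.
Qed.

Lemma mem_column (t j j' : nat) : t <= k -> j < n -> j' < n ->
  (entry t j \in column j') = (j == j').
Proof.
move=> let_k ltj ltj'; apply/mapP/eqP => [[t']|<-]; last by exists t; rewrite ?mem_iota.
by rewrite mem_iota => let'k /entry_inj[].
Qed.

Lemma column_upto_before_entry (t j i : nat) : t <= k -> j < n -> entry t j = i.+1 ->
  column_upto i j = mkseq (entry^~ j) t.
Proof.
move=> let_k ltj entry_tj.
have -> : column_upto i j = [seq x <- column j | x < nth 0 (column j) t].
  by rewrite nth_column // entry_tj.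
have := @Order.POrderTheory.filter_lt_nth _ nat 0 (column j) t (column_sorted ltj).
rewrite size_mkseq => -> //; rewrite -map_take take_iota /mkseq; congr (map _ (iota _ _)).
by apply/minn_idPl/leqW.
Qed.

Lemma column_upto_neq_nil (i j : nat) : entry 0 j <= i -> column_upto i j != [::].
Proof.
move=> le_top; rewrite -has_filter; apply/hasP; exists (entry 0 j) => //=.
exact: mem_head.
Qed.

Lemma last_active_column (i j : nat) : j < n -> has_active k (column_upto i j) ->
  exists t, [/\ t < k, last 0 (column_upto i j) = entry t j & i < entry t.+1 j].
Proof.
move=> ltj; set h := size (column_upto i j) => /andP[h_gt0 ltn_h].
have sorted_j : sorted leq (column j) := sub_sorted ltnW (column_sorted ltj).
have h_count : h = count_leq (column j) i by rewrite /h size_filter.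
have upto_take : column_upto i j = take h (column j).
  by rewrite h_count; apply: (@Order.PreorderTheory.sorted_filter_le _ nat).
exists h.-1; rewrite prednK //; split=> //.
  rewrite -nth_last -/h upto_take nth_take ?prednK // nth_column //.
  by rewrite -ltnS prednK // ltnW.
have lt_size : count_leq (column j) i <= h < size (column j).
  by rewrite -h_count leqnn size_mkseq.
rewrite -nth_column //.
exact: (@Order.TotalTheory.DualTotalTheory.nth_count_gt _ nat _ _ _ _ sorted_j lt_size).
Qed.

Lemma array_uptoS (i t j : nat) : t <= k -> j < n -> entry t j = i.+1 ->
  array_upto i.+1 = extend_column (array_upto i) j i.+1.
Proof.
move=> let_k ltj entry_tj; apply: (@eq_from_nth _ [::]) => [|j'].
  by rewrite size_extend_column !size_mkseq.
rewrite size_mkseq => ltj'; rewrite nth_extend_column !nth_mkseq //.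
rewrite /column_upto filter_leqS ?column_sorted // -entry_tj mem_column // eq_sym entry_tj.
by case: eqVneq => [->|].
Qed.

Lemma place_array_upto_top (i j : nat) : j < n -> entry 0 j = i.+1 ->
  place k (array_upto i) LetterS i.+1 = array_upto i.+1.
Proof.
move=> ltj entry_j; rewrite (array_uptoS (leq0n k) ltj entry_j).
apply: place_LetterS => [||j' ltj'j]; rewrite ?size_mkseq // nth_mkseq //.
- exact: column_upto_before_entry entry_j.
- apply: column_upto_neq_nil; rewrite -ltnS -entry_j ltnNge leq_entry // -ltnNge.
  exact: ltn_key_top.
- exact: ltn_trans ltj.
Qed.

(* The entries right above those still to be placed are the active ones, and by
   [leq_key_above] they are in the same order. *)
Lemma place_array_upto_below (i t j : nat) : t < k -> j < n -> entry t.+1 j = i.+1 ->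
  place k (array_upto i) LetterW i.+1 = array_upto i.+1.
Proof.
move=> ltt ltj entry_tj; rewrite (array_uptoS ltt ltj entry_tj).
have upto_j : column_upto i j = mkseq (entry^~ j) t.+1 by apply: column_upto_before_entry.
have last_j : last 0 (column_upto i j) = entry t j.
  by rewrite upto_j -nth_last size_mkseq nth_mkseq.
apply: place_LetterW; rewrite ?size_mkseq ?nth_mkseq // ?upto_j ?/has_active ?size_mkseq //.
move=> j' ltj' neq_j; rewrite nth_mkseq // -upto_j last_j.
case/(last_active_column ltj') => t' [ltt' -> lt_i].
rewrite ltn_neqAle leq_entry ?(ltnW ltt) // leq_key_above // ?andbT; last first.
  by rewrite -leq_entry // entry_tj.
by apply: contra neq_j => /eqP /(entry_inj (ltnW ltt) ltj (ltnW ltt') ltj')[_ ->].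
Qed.

Lemma place_array_upto (i : nat) (s : step) : i < k.+1 * n ->
  (s == North) = (i.+1 \in mkseq (entry 0) n) ->
  place k (array_upto i) (if s is North then LetterS else LetterW) i.+1 = array_upto i.+1.
Proof.
move=> lti s_top; have [t [j [let_k ltj entry_tj]]] := @entry_surj i.+1 lti.
case: t let_k entry_tj => [|t] let_k entry_tj.
  have /eqP -> : s == North; last exact: place_array_upto_top entry_tj.
  by rewrite s_top -entry_tj; apply: map_f; rewrite mem_iota.
have : s != North.
  by rewrite s_top -entry_tj; apply/mapP => -[j']; rewrite mem_iota => ltj' /entry_inj[].
by case: s {s_top} => // _; apply: place_array_upto_below entry_tj.
Qed.

Lemma mem_top_row1 : 0 < n -> 1 \in mkseq (entry 0) n.
Proof.
move=> n_gt0; have size_gt0 : 0 < k.+1 * n by rewrite muln_gt0.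
have [[|t] [j [let_k ltj entry_tj]]] := @entry_surj 1 size_gt0.
  by rewrite -entry_tj; apply: map_f; rewrite mem_iota.
by have := ltn_entryS let_k ltj; rewrite entry_tj ltnS leqNgt entry_gt0 // ltnW.
Qed.

Lemma array_upto0 : array_upto 0 = nseq n [::].
Proof.
apply: (@eq_from_nth _ [::]) => [|j]; rewrite size_mkseq ?size_nseq // => ltj.
rewrite nth_nseq ltj nth_mkseq //; apply/eqP; rewrite -[_ == _]negbK -has_filter.
apply/hasPn => x /mapP[t]; rewrite mem_iota => let_k ->.
by rewrite -ltnNge entry_gt0.
Qed.

Lemma array_upto_full : array_upto (k.+1 * n) = mkseq column n.
Proof.
apply/eq_in_map => j; rewrite mem_iota => ltj; apply/all_filterP/allP => x /mapP[t _ ->].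
by rewrite -size_keys count_size.
Qed.

Lemma tableau_standardization (D : seq step) : 0 < n ->
  (forall i, i < k.+1 * n -> (nth East D i == North) = (i.+1 \in mkseq (entry 0) n)) ->
  tableau k n D = mkseq column n.
Proof.
move=> n_gt0 north_top.
have north0 : nth East D 0 = North.
  by apply/eqP; rewrite north_top ?mem_top_row1 // muln_gt0.
have placeS i : i < k.+1 * n ->
    place k (array_upto i) (nth LetterW (SW D) i) i.+1 = array_upto i.+1.
  by move=> lti; rewrite nth_SW place_array_upto // north_top.
rewrite tableau_foldl // -array_upto0 -array_upto_full.
elim: (k.+1 * n) placeS => // i IH placeS.
rewrite -[X in iota _ X]addn1 iotaD foldl_cat IH => [|i' lti']; last exact/placeS/ltnW.
by rewrite /= add1n placeS.
Qed.

End FirstInFirstOut.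

Section ResidueGrid.

Variables (k n : nat) (es : seq nat).
Hypothesis n_gt0 : 0 < n.
Hypothesis size_es : size es = n.
Hypothesis sorted_es : sorted ltn es.
Hypothesis es_mod_inj : {in es &, forall e e', e = e' %[mod n] -> e = e'}.

Definition grid : seq nat := [seq e + t * n | e <- es, t <- iota 0 k.+1].

Let key (t j : nat) : nat := nth 0 es j + t * n.

Lemma keys_grid : keys k n key = grid.
Proof. by rewrite /grid -[es](mkseq_nth 0) size_es allpairs_mapl. Qed.

Lemma grid_key_inj (t j t' j' : nat) : t <= k -> j < n -> t' <= k -> j' < n ->
  key t j = key t' j' -> t = t' /\ j = j'.
Proof.
rewrite /key => _ ltj _ ltj' eq_key.
have eq_es : nth 0 es j = nth 0 es j'.
  by apply: es_mod_inj; rewrite ?mem_nth ?size_es // -(modnMDl t) addnC eq_key addnC modnMDl.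
have uniq_es := sorted_uniq ltn_trans ltnn sorted_es.
split; last by apply/eqP; rewrite -(nth_uniq 0 _ _ uniq_es) ?size_es // eq_es.
by move/eqP: eq_key; rewrite eq_es eqn_add2l eqn_pmul2r // => /eqP.
Qed.

Lemma bottom_row_tableau_grid (D : seq step) :
  (forall i, i < k.+1 * n -> (nth East D i == North) = (i.+1 \in map (count_leq grid) es)) ->
  bottom_row k (tableau k n D) = [seq count_leq grid (e + k * n) | e <- es].
Proof.
move=> north_top.
have entry_grid t : mkseq (entry k n key t) n = [seq count_leq grid (e + t * n) | e <- es].
  by rewrite -(mkseq_comp_nth 0) size_es /entry keys_grid.
have lt_es j j' : j < j' -> j' < n -> nth 0 es j < nth 0 es j'.
  move=> ltjj' ltj'; apply: (sorted_ltn_nth ltn_trans 0 sorted_es) => //;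
    by rewrite inE size_es // (ltn_trans ltjj').
rewrite (tableau_standardization grid_key_inj) //.
- by rewrite bottom_row_mkseq entry_grid.
- by move=> j j'; rewrite /key !mul0n !addn0; apply: lt_es.
- by move=> t j _ _; rewrite ltn_add2l ltn_pmul2r.
- by move=> t j t' j' _ _ _ _; rewrite /key !mulSn; lia.
move=> i lti; rewrite entry_grid north_top //; congr (_ \in _).
by apply: eq_map => e; rewrite mul0n addn0.
Qed.

End ResidueGrid.

(* The number of t >= 0 with x + t n <= z; truncated subtraction gives 0 for z < x. *)
Definition hits (n z x : nat) : nat := (z + n - x) %/ n.

Lemma hits_addn (n z x : nat) : 0 < n -> hits n z x = (x <= z) + hits n z (x + n).
Proof.
move=> n_gt0; rewrite /hits subnDr; case: leqP => [lexz|ltzx].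
  by rewrite addnC -addnBA // divnDl ?dvdnn // divnn n_gt0.
by rewrite !divn_small //; lia.
Qed.

Lemma hits_succ (n z x : nat) : 0 < n ->
  hits n z x = (x <= z) && (x == z %[mod n]) + hits n z x.+1.
Proof.
move=> n_gt0; rewrite /hits subnS; case: (leqP x z) => [lexz|ltzx] /=.
  have -> : z + n - x = (z + n - x).-1.+1 by lia.
  rewrite divnS //; congr (_ + _).
  have -> : (z + n - x).-1.+1 = z + n - x by lia.
  by rewrite -eqn_mod_dvd ?(leq_trans lexz) ?leq_addr // modnDr eq_sym.
by rewrite !divn_small; lia.
Qed.

Lemma hits_telescope (n z x j : nat) : 0 < n ->
  hits n z x = count_leq [seq x + t * n | t <- iota 0 j] z + hits n z (x + j * n).
Proof.
move=> n_gt0; elim: j => [|j IH]; first by rewrite mul0n addn0.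
rewrite IH (hits_addn _ (x + j * n)) // mulSn (addnC n) !addnA; congr (_ + _).
by rewrite -[in RHS]addn1 iotaD map_cat /count_leq count_cat /= addn0.
Qed.

Lemma sum_hits (n z : nat) (s : seq nat) : 0 < n ->
  \sum_(x <- s) hits n z x = count_leq s z + \sum_(x <- s) hits n z (x + n).
Proof.
move=> n_gt0; rewrite /count_leq -sumn_count sumnE big_map -big_split /=.
by apply: eq_bigr => x _; rewrite hits_addn.
Qed.

Lemma sum_hits_grid (k n z : nat) (es : seq nat) : 0 < n ->
  \sum_(e <- es) hits n z e =
  count_leq (grid k n es) z + \sum_(e <- es) hits n z (e + k.+1 * n).
Proof.
move=> n_gt0; elim: es => [|e es IH]; first by rewrite !big_nil.
rewrite !big_cons IH (@hits_telescope n z e k.+1) // /grid.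
by rewrite (allpairs_cons (fun e t => e + t * n)) /count_leq count_cat addnACA.
Qed.

Lemma perm_step_into (T : eqType) (P : seq step) (F : nat -> step -> T) :
  F 0 (last East P) = F (size P) (last East P) ->
  perm_eq [seq F i (step_into P i) | i <- iota 0 (size P)]
          [seq F i.+1 (nth East P i) | i <- iota 0 (size P)].
Proof.
case/lastP: P => // s x; rewrite size_rcons last_rcons => F0.
rewrite -[in X in perm_eq _ X]addn1 iotaD map_cat /= last_rcons F0.
rewrite nth_rcons ltnn eqxx perm_sym cats1 perm_rcons (iotaDl 1) -map_comp.
by rewrite (eq_map (g := (fun i => F i (step_into (rcons s x) i)) \o addn 1)).
Qed.

Lemma perm_EN (m n : nat) (P : seq step) : perm_eq (EN m n P) P.
Proof.
rewrite -[X in perm_eq _ X](mkseq_nth East).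
apply: perm_trans (perm_step_into (F := fun _ s => s) _) => //.
by apply: perm_map; rewrite perm_sort.
Qed.

Definition nat_rank (m n : nat) (P : seq step) (i : nat) : nat :=
  (vertex P i).2 * m - (vertex P i).1 * n.

Lemma vertexS (P : seq step) (i : nat) : i < size P -> vertex P i.+1 =
  if nth East P i is North then ((vertex P i).1, (vertex P i).2.+1)
  else ((vertex P i).1.+1, (vertex P i).2).
Proof.
move=> ltiP; rewrite /vertex (take_nth East) // -cats1 !count_cat /=.
by case: (nth East P i) => /=; rewrite !addn0 addn1.
Qed.

Lemma vertex_sum (P : seq step) (i : nat) : i <= size P ->
  (vertex P i).1 + (vertex P i).2 = i.
Proof.
elim: i => [|i IH] lti; first by rewrite /vertex take0.
by rewrite vertexS //; case: (nth _ _ _); rewrite /= ?addnS ?addSn IH // ltnW.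
Qed.

Lemma leq_height (P : seq step) (i j : nat) :
  i <= j -> (vertex P i).2 <= (vertex P j).2.
Proof. by move=> leij; rewrite /vertex /= -(subnKC leij) takeD count_cat leq_addr. Qed.

Section Ranks.

Variables (m n : nat) (P : seq step).
Hypothesis dyckP : dyck m n P.

Local Notation rk := (nat_rank m n P).

Definition ranks : seq nat := mkseq rk (size P).
Definition ranks_of (f : nat -> step) (s : step) : seq nat :=
  [seq rk i | i <- iota 0 (size P) & f i == s].
Definition start_ranks : step -> seq nat := ranks_of (nth East P).
Definition end_ranks : step -> seq nat := ranks_of (step_into P).

Lemma vertex_end : vertex P (size P) = (m, n).
Proof. by case/andP: dyckP => /eqP. Qed.

Lemma dyck_above (i : nat) : i <= size P -> (vertex P i).1 * n <= (vertex P i).2 * m.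
Proof. by case/andP: dyckP => _ /allP above leiP; apply: above; rewrite mem_iota. Qed.

Lemma size_dyck : size P = m + n.
Proof. by rewrite -[LHS](vertex_sum (leqnn _)) vertex_end. Qed.

Lemma rankE (i : nat) : i <= size P -> rank m n (vertex P i) = (rk i)%:Z%R.
Proof. by move/dyck_above; rewrite /rank /nat_rank; lia. Qed.

Lemma nat_rank_end : rk (size P) = rk 0.
Proof. by rewrite /nat_rank vertex_end /vertex take0 /= mulnC subnn. Qed.

Lemma nat_rank_North (i : nat) : i < size P -> nth East P i = North -> rk i.+1 = rk i + m.
Proof.
move=> ltiP north_i; have := dyck_above (ltnW ltiP).
by rewrite /nat_rank vertexS // north_i /= mulSn; lia.
Qed.

Lemma nat_rank_East (i : nat) : i < size P -> nth East P i = East -> rk i.+1 + n = rk i.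
Proof.
move=> ltiP east_i; have := dyck_above ltiP.
by rewrite /nat_rank vertexS // east_i /= mulSn; lia.
Qed.

Lemma perm_ranks_of (f : nat -> step) :
  perm_eq ranks (ranks_of f North ++ ranks_of f East).
Proof.
rewrite -map_cat; apply: perm_map; rewrite perm_sym.
rewrite [X in _ ++ X](eq_filter (a2 := predC (fun i => f i == North))) => [|i /=].
  by rewrite perm_filterC.
by case: (f i).
Qed.

Lemma perm_end_ranks (s : step) :
  perm_eq (end_ranks s) [seq rk i.+1 | i <- iota 0 (size P) & nth East P i == s].
Proof.
have := @perm_step_into _ P (fun i s => (rk i, s)); rewrite nat_rank_end => /(_ erefl).
move/(perm_filter (fun x => x.2 == s))/(perm_map fst).
by rewrite !filter_map -!map_comp.
Qed.

Lemma perm_end_ranks_North :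
  perm_eq (end_ranks North) [seq e + m | e <- start_ranks North].
Proof.
rewrite (permPl (perm_end_ranks _)) -map_comp.
suff /eq_in_map -> : {in [seq i <- iota 0 (size P) | nth East P i == North],
  (fun i => rk i.+1) =1 addn^~ m \o rk} by [].
move=> i; rewrite mem_filter mem_iota => /andP[/eqP north_i lti].
exact: nat_rank_North.
Qed.

Lemma perm_end_ranks_East :
  perm_eq [seq r + n | r <- end_ranks East] (start_ranks East).
Proof.
rewrite (permPl (perm_map _ (perm_end_ranks _))) -map_comp.
suff /eq_in_map -> : {in [seq i <- iota 0 (size P) | nth East P i == East],
  addn^~ n \o (fun i => rk i.+1) =1 rk} by [].
move=> i; rewrite mem_filter mem_iota => /andP[/eqP east_i lti].
exact: nat_rank_East.
Qed.

Lemma mem_ranks_North_end (e : nat) : e \in start_ranks North -> e + m \in ranks.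
Proof.
move=> start_e; rewrite (perm_mem (perm_ranks_of (step_into P))) mem_cat.
by rewrite (perm_mem perm_end_ranks_North) (map_f (addn^~ m)).
Qed.

(* East steps lower the rank by n, hence their contributions cancel. *)
Lemma sum_ranks_shift (H : nat -> nat) :
  \sum_(r <- ranks) H (r + n) + \sum_(e <- start_ranks North) H e =
  \sum_(r <- ranks) H r + \sum_(e <- start_ranks North) H (e + m + n).
Proof.
have end_North : \sum_(r <- end_ranks North) H (r + n) =
    \sum_(e <- start_ranks North) H (e + m + n).
  by rewrite (perm_big _ perm_end_ranks_North) big_map.
have end_East : \sum_(r <- end_ranks East) H (r + n) = \sum_(r <- start_ranks East) H r.
  by rewrite -(perm_big _ perm_end_ranks_East) [RHS]big_map.
rewrite (perm_big _ (perm_ranks_of (step_into P))) big_cat end_North end_East.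
by rewrite (perm_big _ (perm_ranks_of (nth East P))) big_cat addnAC -addnA addnC.
Qed.

Lemma sum_hits_start_ranks (z : nat) : 0 < n ->
  \sum_(e <- start_ranks North) hits n z e =
  count_leq ranks z + \sum_(e <- start_ranks North) hits n z (e + m + n).
Proof.
move=> n_gt0; have := sum_ranks_shift (hits n z).
by rewrite (@sum_hits n z ranks) //; lia.
Qed.

Lemma size_rank_order : size (rank_order m n P) = size P.
Proof. by rewrite size_sort size_iota. Qed.

Lemma mem_rank_order (i : nat) : (i \in rank_order m n P) = (i < size P).
Proof. by rewrite mem_sort mem_iota. Qed.

Lemma map_rank_order : map rk (rank_order m n P) = sort leq ranks.
Proof.
apply: (sorted_eq leq_trans anti_leq); last first.
- by rewrite perm_sym perm_sort perm_sym; apply: perm_map; rewrite perm_sort.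
- exact/sort_sorted/leq_total.
have in_path : all (fun i => i < size P) (rank_order m n P).
  by apply/allP => i; rewrite mem_rank_order.
rewrite sorted_map; apply: (sub_in_sorted _ in_path); last first.
  by apply: sort_sorted => i j; apply: Order.TotalTheory.le_total.
move=> i j lti ltj.
by rewrite (rankE (ltnW lti)) (rankE (ltnW ltj)).
Qed.

Section Coprime.

Hypothesis n_gt0 : 0 < n.
Hypothesis coprime_mn : coprime m n.

Lemma nat_rank_mod (i : nat) : i <= size P -> rk i = (vertex P i).2 * m %[mod n].
Proof. by move=> lei; rewrite -(modnMDl (vertex P i).1) addnC subnK // dyck_above. Qed.

Lemma eqn_mod_height (i j : nat) : i <= size P -> j <= size P ->
  (rk i == rk j %[mod n]) = ((vertex P i).2 == (vertex P j).2 %[mod n]).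
Proof. by move=> lei lej; rewrite !nat_rank_mod // eqn_mod_mul2r. Qed.

Lemma nat_rank_inj (i j : nat) : i < size P -> j < size P -> rk i = rk j -> i = j.
Proof.
wlog lt_ij : i j / i < j => [wlog_ij|] lti ltj eq_rk.
  by case: (ltngtP i j) => // ltij; [apply: wlog_ij|apply/esym/wlog_ij].
have le_y := leq_height P (ltnW lt_ij).
have /dvdnP[q eq_q] : n %| (vertex P j).2 - (vertex P i).2.
  by rewrite -eqn_mod_dvd // -(eqn_mod_height (ltnW ltj) (ltnW lti)) eq_rk.
have le_yn : (vertex P j).2 <= n by have := leq_height P (ltnW ltj); rewrite vertex_end.
have [sum_i sum_j] := (vertex_sum (ltnW lti), vertex_sum (ltnW ltj)).
have [above_i above_j] := (dyck_above (ltnW lti), dyck_above (ltnW ltj)).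
have le_q1 : q <= 1 by rewrite -(leq_pmul2r n_gt0); lia.
have eq_x : (vertex P j).1 = (vertex P i).1 + q * m.
  have y_j : (vertex P j).2 = q * n + (vertex P i).2 by lia.
  apply/eqP; rewrite -(eqn_pmul2r n_gt0) mulnDl mulnAC -mulnA; apply/eqP.
  by move: eq_rk above_i above_j; rewrite /nat_rank y_j mulnDl mulnAC; lia.
by have := size_dyck; case: q le_q1 eq_q eq_x => [|[|//]] _; lia.
Qed.

Lemma ranks_uniq : uniq ranks.
Proof.
rewrite map_inj_in_uniq ?iota_uniq // => i j; rewrite !mem_iota => lti ltj.
exact: nat_rank_inj.
Qed.

Lemma size_ranks : size ranks = size P.
Proof. exact: size_mkseq. Qed.

Lemma mem_ranks (i : nat) : i < size P -> rk i \in ranks.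
Proof. by move=> lti; apply: map_f; rewrite mem_iota. Qed.

Lemma start_ranks_uniq (s : step) : uniq (start_ranks s).
Proof.
have := ranks_uniq; rewrite (perm_uniq (perm_ranks_of (nth East P))) cat_uniq.
by case/and3P; case: s.
Qed.

Lemma size_start_ranks_North : size (start_ranks North) = n.
Proof.
rewrite size_map size_filter -(count_map (nth East P) (pred1 North)) -/(mkseq _ _) mkseq_nth.
by have := vertex_end; rewrite /vertex take_size => -[].
Qed.

Lemma start_ranks_North_mod_inj :
  {in start_ranks North &, forall e e', e = e' %[mod n] -> e = e'}.
Proof.
have leq_heightS i l : i < l -> l <= size P -> nth East P i = North ->
    (vertex P i).2 < (vertex P l).2.
  move=> ltil lel north_i; have := leq_height P ltil.
  by rewrite vertexS ?north_i // (leq_trans ltil).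
move=> _ _ /mapP[i + ->] /mapP[j + ->]; rewrite !mem_filter !mem_iota /=.
move=> /andP[/eqP north_i lti] /andP[/eqP north_j ltj] /eqP.
have height_lt l : l < size P -> nth East P l = North -> (vertex P l).2 < n.
  by move=> ltl /(leq_heightS _ _ ltl (leqnn _)); rewrite vertex_end.
rewrite eqn_mod_height ?(ltnW lti) ?(ltnW ltj) // !modn_small ?height_lt // => /eqP eq_y.
case: (ltngtP i j) => [ltij|ltji|-> //].
  by have := leq_heightS _ _ ltij (ltnW ltj) north_i; rewrite eq_y ltnn.
by have := leq_heightS _ _ ltji (ltnW lti) north_j; rewrite eq_y ltnn.
Qed.

Lemma nth_map_rank_order (f : nat -> step) (s : step) (p : nat) : p < size P ->
  (nth East (map f (rank_order m n P)) p == s) =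
  (p.+1 \in map (count_leq ranks) (ranks_of f s)).
Proof.
move=> ltp; rewrite (nth_map 0) ?size_rank_order //.
have := count_leq_nth_sort ranks_uniq; rewrite size_ranks => /(_ _ ltp).
have := mem_nth 0 (_ : p < size (rank_order m n P)).
rewrite size_rank_order mem_rank_order => /(_ ltp).
rewrite -map_rank_order (nth_map 0) ?size_rank_order //.
move: (nth 0 _ p) => v ltv count_v; rewrite -count_v.
apply/eqP/mapP => [fv|[_ /mapP[i + ->]]].
  by exists (rk v) => //; apply: map_f; rewrite mem_filter fv eqxx mem_iota.
rewrite mem_filter mem_iota => /andP[/eqP fi lti].
move/(count_leq_inj (mem_ranks ltv) (mem_ranks lti)).
by move/(nat_rank_inj ltv lti) => ->.
Qed.

End Coprime.

End Ranks.

Section FussCatalan.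

Variables (k n : nat) (P : seq step).
Let m : nat := k * n + 1.
Hypothesis n_gt0 : 0 < n.
Hypothesis dyckP : dyck m n P.

Definition north_starts : seq nat := sort leq (start_ranks m n P North).

Local Notation path_ranks := (ranks m n P).
Local Notation es := north_starts.
Local Notation start_grid := (grid k n es).

Let coprime_mn : coprime m n.
Proof. by rewrite coprime_sym /coprime gcdnMDl gcdn1. Qed.

Lemma mem_north_starts : es =i start_ranks m n P North.
Proof. exact: mem_sort. Qed.

Lemma size_north_starts : size es = n.
Proof. by rewrite size_sort (size_start_ranks_North dyckP). Qed.

Lemma north_starts_sorted : sorted ltn es.
Proof.
apply: etrans (Order.TotalTheory.sort_lt_sorted _) _.
exact: start_ranks_uniq.
Qed.

Lemma north_starts_mod_inj : {in es &, forall e e', e = e' %[mod n] -> e = e'}.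
Proof.
move=> e e'; rewrite !mem_north_starts.
exact: start_ranks_North_mod_inj.
Qed.

(* A North step raises the rank by m, and m + n = (k + 1) n + 1, so that the sums
   of sum_hits_grid and sum_hits_start_ranks differ by a shift by 1. *)
Lemma count_leq_ranks (z : nat) :
  count_leq path_ranks z = count_leq start_grid z +
    count (fun e => (e + k.+1 * n <= z) && (e == z %[mod n])) es.
Proof.
have := sum_hits_start_ranks dyckP z n_gt0.
rewrite -!(perm_big _ (permEl (perm_sort leq (start_ranks m n P North)))) -/es /=.
rewrite (sum_hits_grid k) // (eq_bigr (fun e =>
    ((e + k.+1 * n <= z) && (e == z %[mod n]) : nat) + hits n z (e + m + n))) => [|e _].
  by rewrite big_split -sumn_count sumnE big_map addnA => /addIn ->.
rewrite hits_succ // -{2}[e + _]addnC modnMDl; congr (_ + hits n z _).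
by rewrite /m mulSn; lia.
Qed.

Lemma count_leq_ranks_grid (e t : nat) : e \in es -> t <= k ->
  count_leq path_ranks (e + t * n) = count_leq start_grid (e + t * n).
Proof.
move=> start_e let_k; rewrite count_leq_ranks.
rewrite (eq_in_count (a2 := pred0)) ?count_pred0 ?addn0 //.
move=> e' start_e' /=; apply/negP => /andP[le_e' /eqP].
rewrite [e + _]addnC modnMDl => /(north_starts_mod_inj start_e' start_e) eq_e.
by move: le_e'; rewrite eq_e leq_add2l leq_pmul2r // ltnNge let_k.
Qed.

Lemma count_leq_ranks_end (e : nat) : e \in es ->
  count_leq path_ranks (e + m) = (count_leq start_grid (e + k * n)).+1.
Proof.
move=> start_e; have end_e : e + m \in path_ranks.
  by apply: (mem_ranks_North_end dyckP); rewrite -mem_north_starts.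
have succ_e : e + m = (e + k * n).+1 by rewrite /m addn1 addnS.
rewrite succ_e in end_e *.
by rewrite count_leqS ?count_leq_ranks_grid // (ranks_uniq dyckP).
Qed.

Lemma sweep_North (p : nat) : p < size P ->
  (nth East (sweep m n P) p == North) = (p.+1 \in map (count_leq start_grid) es).
Proof.
move=> ltp; rewrite (nth_map_rank_order dyckP) // -(eq_mem_map _ mem_north_starts).
suff /eq_in_map -> : {in es, count_leq path_ranks =1 count_leq start_grid} by [].
by move=> e start_e; have := count_leq_ranks_grid start_e (leq0n k); rewrite mul0n addn0.
Qed.

Lemma bottom_row_tableau_sweep :
  bottom_row k (tableau k n (sweep m n P)) = [seq count_leq start_grid (e + k * n) | e <- es].
Proof.
apply: bottom_row_tableau_grid => //.
- exact: size_north_starts.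
- exact: north_starts_sorted.
- exact: north_starts_mod_inj.
by move=> i lti; rewrite sweep_North // (size_dyck dyckP) /m; lia.
Qed.

Lemma EN_North (p : nat) : p < size P ->
  (nth East (EN m n P) p == North) =
  (p \in bottom_row k (tableau k n (sweep m n P))).
Proof.
move=> ltp; rewrite (nth_map_rank_order dyckP) // bottom_row_tableau_sweep.
rewrite (perm_mem (perm_map _ (perm_end_ranks_North dyckP))) -map_comp.
rewrite -(eq_mem_map _ mem_north_starts) -[RHS](mem_map succn_inj) -map_comp.
suff /eq_in_map -> : {in es, count_leq path_ranks \o addn^~ m =1
  succn \o (fun e => count_leq start_grid (e + k * n))} by [].
exact: count_leq_ranks_end.
Qed.

End FussCatalan.

Theorem theorem1p3 (k n m : nat) (hk : 1 <= k) (hn : 1 <= n)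
    (hm : m = k * n + 1)
    (D : seq step) (hD : dyck m n D)
    (Dbar : seq step) (hDbar : dyck m n Dbar) (hsweep : sweep m n Dbar = D) :
  let x (i : nat) := nth East (EN m n Dbar) i.-1 in
  let b := bottom_row k (tableau k n D) in
  (forall i : nat, 1 <= i <= m + n ->
     (x i = North <-> i \in [seq bj + 1 | bj <- b]) /\
     (i \notin [seq bj + 1 | bj <- b] -> x i = East)) /\
  count_mem East (EN m n Dbar) = m.
Proof.
subst m D => x b; split; last first.
  rewrite (permP (perm_EN _ _ _)).
  by have := vertex_end hDbar; rewrite /vertex take_size => -[].
move=> [//|i] /= lti.
have x_North : (x i.+1 == North) = (i.+1 \in [seq bj + 1 | bj <- b]).
  by rewrite /x EN_North ?(size_dyck hDbar) // -(mem_map (@addIn 1)) addn1.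
rewrite -x_North; split; first by split => /eqP.
by case: (x _).
Qed.
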